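(* Let $s\ge 1$ be an integer and let $G$ be a multipartite graph with a partition $\mathcal{P}=(V_1,V_2,\ldots,V_r)$. (1) Let $t\ge 1$ be an integer. If for each $i\in[r]$ we have $|V_i|\ge t$ and $V_i$ is incident with at most $\frac{t}{4s^2}|V_i|$ edges, then $G$ has at least $$\frac{1}{2^r}\binom{t}{s}^r$$ independent transversal blow-ups of size $s$ with respect to $\mathcal{P}$. (2) Consequently, if $D>0$ is such that $4s^2D$ is an integer, $\overline{D}_{\mathcal{P}}(G)\le D$, and $\mathcal{P}$ is $4s^2D$-thick, then $G$ has at least $\frac{1}{2^r}\binom{4s^2D}{s}^r$ independent transversal blow-ups of size $s$ with respect to $\mathcal{P}$.
   Context: All graphs are finite and simple. A multipartite graph $G$ with partition $\mathcal{P}=(V_1,\ldots,V_r)$ is a graph whose vertex set is the disjoint union of the blocks $V_1,\ldots,V_r$, each of which is an independent set of $G$. An edge is incident with $V_i$ if it has an endpoint in $V_i$. The partition $\mathcal{P}$ is $x$-thick if $|V_i|\ge x$ for every $i\in[r]$. The average degree of a block is $\overline{d}_G(V_i)=\frac{1}{|V_i|}\sum_{v\in V_i}d_G(v)$, and the maximum block average degree is $\overline{D}_{\mathcal{P}}(G)=\max_{i\in[r]}\overline{d}_G(V_i)$. An independent transversal blow-up of size $s$ with respect to $\mathcal{P}$ is an independent set of $G$ containing exactly $s$ vertices from each block $V_i$; distinct blow-ups are counted as distinct vertex sets and need not be disjoint. *)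

(* Defs.v *)
From mathcomp Require Import all_boot all_order all_algebra.

Set Implicit Arguments.
Unset Strict Implicit.
Unset Printing Implicit Defensive.

Import Order.TTheory GRing.Theory Num.Theory.
Local Open Scope ring_scope.

(* A finite simple graph is a symmetric irreflexive relation [e : rel T] on a
   finite type [T] of vertices. *)

Definition edges (T : finType) (e : rel T) : {set {set T}} :=
  [set [set p.1; p.2] | p : T * T & e p.1 p.2].

Definition degree (T : finType) (e : rel T) (v : T) : nat :=
  #|[set w | e v w]|.

Definition independent (T : finType) (e : rel T) (S : {set T}) : bool :=
  [forall x in S, forall y in S, ~~ e x y].

Definition multipartite (T : finType) (e : rel T) (r : nat)
    (V : 'I_r -> {set T}) : Prop :=
  [/\ forall x : T, exists i : 'I_r, x \in V i,
      forall i j : 'I_r, i != j -> [disjoint V i & V j]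
    & forall i : 'I_r, independent e (V i)].

Definition incident_edges (T : finType) (e : rel T) (A : {set T}) :
    {set {set T}} :=
  [set f in edges e | [exists x in f, x \in A]].

(* The thickness is a number of [R], not a natural number, so that it can be
   written as an expression in a real parameter. *)
Definition thick (R : realFieldType) (T : finType) (r : nat)
    (V : 'I_r -> {set T}) (x : R) : Prop :=
  forall i : 'I_r, x <= #|V i|%:R.

Definition block_avg_degree (R : realFieldType) (T : finType) (e : rel T)
    (A : {set T}) : R :=
  #|A|%:R^-1 * \sum_(v in A) (degree e v)%:R.

(* Average degrees are nonnegative, so starting the maximum at 0 only matters
   when [r = 0]. *)
Definition max_block_avg_degree (R : realFieldType) (T : finType) (e : rel T)
    (r : nat) (V : 'I_r -> {set T}) : R :=
  \big[Num.max/0]_(i < r) block_avg_degree R e (V i).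

Definition transversal_blowups (T : finType) (e : rel T) (r : nat)
    (V : 'I_r -> {set T}) (s : nat) : {set {set T}} :=
  [set S : {set T} | independent e S & [forall i, #|S :&: V i| == s]].

(* Main.v *)
(** Let [P(J)] be the number of independent transversal blow-ups on the blocks
    indexed by [J].  In the style of Rosenfeld's counting argument,
    one shows by induction on [#|J|] that
      2 P(J + i) >= C(|V_i|, s) P(J)   for every [i] outside [J].
    Among the C(|V_i|, s) P(J) pairs made of an [s]-subset of [V_i] and a blow-up
    on [J], a pair fails to give a blow-up on [J + i] only if some edge [vw], with
    [v] in [V_i], has [v] in the subset and [w] in the blow-up.  There are
    (s / |V_i|) C(|V_i|, s) subsets containing [v], and, by induction applied to
    the block [V_j] containing [w], at most
      (s / |V_j|) C(|V_j|, s) P(J - j) <= (2 s / t) P(J)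
    blow-ups containing [w].  The bound on the number of edges then makes at most
    half of the pairs fail. *)

Require Import Defs.
From mathcomp Require Import all_boot all_order all_algebra.
From mathcomp Require Import zify ring.

Set Implicit Arguments.
Unset Strict Implicit.
Unset Printing Implicit Defensive.

Import Order.TTheory GRing.Theory Num.Theory.
Local Open Scope ring_scope.

(** The boolean factor forces [S] to avoid every block outside [J], so one type of sets serves all
    [J]: [J = setT] gives back [transversal_blowups]. *)
Definition partial_blowups (T : finType) (e : rel T) (r : nat)
    (V : 'I_r -> {set T}) (s : nat) (J : {set 'I_r}) : {set {set T}} :=
  [set S : {set T} | independent e S & [forall i, #|S :&: V i| == (i \in J) * s]%N].

Lemma independentP (T : finType) (e : rel T) (S : {set T}) :
  reflect {in S &, forall x y, ~~ e x y} (independent e S).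
Proof.
apply: (iffP 'forall_in_'forall_in_idP) => H x.
  by move=> y /H; apply.
by move=> xS y; apply: H.
Qed.

Lemma independentS (T : finType) (e : rel T) (A B : {set T}) :
  A \subset B -> independent e B -> independent e A.
Proof.
move=> /subsetP sAB /independentP indB; apply/independentP => x y /sAB xB /sAB yB.
exact: indB.
Qed.

(** Deleting [v] injects these sets into the [k.-1]-subsets of [B :\ v], and n C(n-1, k-1) = k C(n,
    k); for [k = 0] there are none. *)
Lemma card_draws_mem (T : finType) (B : {set T}) (k : nat) (v : T) :
  v \in B ->
  (#|B| * #|[set A : {set T} | [&& A \subset B, #|A| == k & v \in A]]|
     <= k * 'C(#|B|, k))%N.
Proof.
move=> vB; case: k => [|k].
  rewrite [X in (_ * X)%N]eq_card0 ?muln0 // => A; rewrite !inE; apply/negbTE/and3P => -[_ A0 vA].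
  by move: A0; rewrite cards_eq0 => /eqP A0; rewrite A0 inE in vA.
have cardBv : #|B :\ v| = #|B|.-1 by rewrite (cardsD1 v B) vB.
rewrite -mul_bin_diag leq_mul2l -cardBv -cards_draws; apply/orP; right.
rewrite -(@card_in_imset _ _ (fun A => A :\ v)); last first.
  move=> A1 A2; rewrite !inE => /and3P[_ _ v1] /and3P[_ _ v2] eqA.
  by rewrite -(setD1K v1) -(setD1K v2) eqA.
apply/subset_leq_card/subsetP => _ /imsetP[A + ->]; rewrite !inE => /and3P[sAB cA vA].
rewrite setSD //=; move: cA; rewrite (cardsD1 v A) vA add1n eqSS => cA.
by rewrite cA.
Qed.

(** By independence an edge meeting [A] has just one endpoint there, so an arc leaving [A] is
    determined by its unordered pair. *)
Lemma card_arcs_incident (T : finType) (e : rel T) (A : {set T}) :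
  independent e A ->
  (#|[set p : T * T | e p.1 p.2 & p.1 \in A]| <= #|incident_edges e A|)%N.
Proof.
move=> /independentP indA.
rewrite -(@card_in_imset _ _ (fun p : T * T => [set p.1; p.2])); last first.
  move=> [v w] [v' w']; rewrite !inE /= => /andP[evw vA] /andP[evw' vA'] eqS.
  have wA : w \notin A by exact: contraL (indA v w vA) evw.
  have wA' : w' \notin A by exact: contraL (indA v' w' vA') evw'.
  have: v \in [set v'; w'] by rewrite -eqS set21.
  rewrite !inE => /orP[/eqP ev|/eqP ev]; last by rewrite -ev vA in wA'.
  have: w \in [set v'; w'] by rewrite -eqS set22.
  rewrite !inE => /orP[/eqP ew|/eqP ->]; last by rewrite ev.
  by rewrite ew vA' in wA.
apply/subset_leq_card/subsetP => _ /imsetP[[v w] + ->]; rewrite !inE /= => /andP[evw vA].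
apply/andP; split; first by apply/imsetP; exists (v, w); rewrite ?inE.
by apply/existsP; exists v; rewrite !inE eqxx.
Qed.

(** The degree sum counts the arcs starting in [A], and by symmetry every incident edge is the image
    of such an arc. This takes average degrees to edge counts in part (2). *)
Lemma card_incident_degree (T : finType) (e : rel T) (A : {set T}) :
  symmetric e ->
  (#|incident_edges e A| <= \sum_(v in A) degree e v)%N.
Proof.
move=> e_sym.
pose arcs := [set p : T * T | e p.1 p.2 & p.1 \in A].
have -> : (\sum_(v in A) degree e v)%N = #|arcs|.
  under eq_bigr => v _ do rewrite /degree -sum1_card.
  rewrite pair_big_dep /= -sum1_card; apply: eq_bigl => -[v w].
  by rewrite !inE andbC.
apply: leq_trans (leq_imset_card (fun p : T * T => [set p.1; p.2]) arcs).
apply/subset_leq_card/subsetP => f; rewrite !inE.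
move=> /andP[/imsetP[[v w]]]; rewrite inE /= => evw -> /existsP[x /andP[+ xA]].
rewrite !inE => /orP[] /eqP xE; subst x; apply/imsetP.
  by exists (v, w) => //; rewrite inE /= evw.
by exists (w, v); rewrite ?inE /= 1?e_sym ?evw // setUC.
Qed.

Lemma partial_blowups_block (T : finType) (e : rel T) (r : nat)
    (V : 'I_r -> {set T}) (s : nat) (J : {set 'I_r}) (S : {set T}) (i : 'I_r)
    (w : T) :
  S \in partial_blowups e V s J -> w \in S -> w \in V i -> i \in J.
Proof.
rewrite inE => /andP[_ /forallP/(_ i)] + wS wV; apply: contraLR => /negbTE ->.
by rewrite mul0n cards_eq0; apply/set0Pn; exists w; rewrite inE wS.
Qed.

(** A blow-up [S] is determined by [S :&: V j], an [s]-subset containing [w], and [S :\: V j], a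
    blow-up on [J :\ j]. *)
Lemma card_partial_blowups_mem (T : finType) (e : rel T) (r : nat)
    (V : 'I_r -> {set T}) (s : nat) (J : {set 'I_r}) (j : 'I_r) (w : T) :
  multipartite e V -> j \in J -> w \in V j ->
  (#|V j| * #|[set S in partial_blowups e V s J | w \in S]|
     <= s * 'C(#|V j|, s) * #|partial_blowups e V s (J :\ j)|)%N.
Proof.
move=> [_ disjV _] jJ wV.
apply: leq_trans (leq_mul (card_draws_mem s wV) (leqnn _)).
rewrite -mulnA leq_mul2l -cardsX; apply/orP; right.
rewrite -(@card_in_imset _ _ (fun S => (S :&: V j, S :\: V j))); last first.
  by move=> S1 S2 _ _ [eqI eqD]; rewrite -(setID S1 (V j)) eqI eqD setID.
apply/subset_leq_card/subsetP => _ /imsetP[S + ->].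
rewrite !inE /= => /andP[/andP[indS /forallP cS] wS].
rewrite subsetIr wS wV (eqP (cS j)) jJ mul1n eqxx /=.
rewrite (independentS (subsetDl _ _) indS); apply/forallP => k.
rewrite !inE; have [->|kj] := eqVneq k j.
  by rewrite mul0n setIDAC -setIDA setDv setI0 cards0.
rewrite -(eqP (cS k)); apply/eqP/eq_card => x; rewrite !inE.
have := disjointFr (disjV _ _ kj); case: (x \in V k) / idP => xk; last by rewrite !andbF.
by move=> /(_ x xk) ->.
Qed.

(** The induction hypothesis enters only through the bound on the blow-ups containing a given vertex
    [w], stated without division. *)
Lemma blowups_extend_step (T : finType) (e : rel T) (r : nat)
    (V : 'I_r -> {set T}) (s t : nat) (J : {set 'I_r}) (i : 'I_r) :
  symmetric e -> multipartite e V -> (0 < t <= #|V i|)%N ->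
  (4 * s ^ 2 * #|incident_edges e (V i)| <= t * #|V i|)%N ->
  (forall w, t * #|[set S in partial_blowups e V s J | w \in S]|
     <= 2 * s * #|partial_blowups e V s J|)%N ->
  i \notin J ->
  ('C(#|V i|, s) * #|partial_blowups e V s J|
     <= 2 * #|partial_blowups e V s (i |: J)|)%N.
Proof.
move=> e_sym [_ disjV indV] /andP[t0 tV] eV memP iJ.
pose draws := [set A : {set T} | A \subset V i & #|A| == s].
pose P := partial_blowups e V s J.
pose P' := partial_blowups e V s (i |: J).
pose arcs := [set p : T * T | e p.1 p.2 & p.1 \in V i].
(* The pairs spoiled by the arc [p]: its tail is in the subset, its head in the blow-up. *)
pose fails (p : T * T) :=
  setX [set A : {set T} | [&& A \subset V i, #|A| == s & p.1 \in A]]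
       [set S in P | p.2 \in S].
pose good := [set q in setX draws P | independent e (q.1 :|: q.2)].
have offV S : S \in P -> S :&: V i = set0.
  rewrite inE => /andP[_ /forallP/(_ i)].
  by rewrite (negbTE iJ) mul0n cards_eq0 => /eqP.
(* Blow-ups on [J] avoid [V i], so a union is split back by intersecting with [V i] and by removing
   [V i]. *)
have le_good : (#|good| <= #|P'|)%N.
  rewrite -(@card_in_imset _ _ (fun q => q.1 :|: q.2)); last first.
    have offD S : S \in P -> S :\: V i = S.
      by move=> /offV S0; rewrite -[RHS](setID S (V i)) S0 set0U.
    move=> [A S] [A' S'] /setIdP[/setXP[+ SP] _] /setIdP[/setXP[+ SP'] _] /=.
    rewrite !inE => /andP[sA _] /andP[sA' _] eqU.
    have := congr1 (setI (V i)) eqU; have := congr1 (fun X => X :\: V i) eqU.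
    rewrite /= !setDUl !setIUr !(setIC (V i)).
    rewrite (offV _ SP) (offV _ SP') (offD _ SP) (offD _ SP') !setU0.
    have -> : A :\: V i = set0 by apply/eqP; rewrite setD_eq0.
    have -> : A' :\: V i = set0 by apply/eqP; rewrite setD_eq0.
    by rewrite !set0U (setIidPl sA) (setIidPl sA') => -> ->.
  apply/subset_leq_card/subsetP => _ /imsetP[[A S] + ->].
  rewrite !inE /= -!andbA => /and5P[sA /eqP cA indS cS indU].
  have S0 : S :&: V i = set0 by apply: offV; rewrite !inE indS.
  rewrite indU; apply/forallP => k; rewrite setIUl !inE.
  have [->|ki] := eqVneq k i.
    by rewrite S0 setU0 (setIidPl sA) cA mul1n.
  have -> : A :&: V k = set0.
    by apply/disjoint_setI0/(disjointWl sA)/disjV; rewrite eq_sym.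
  by rewrite set0U (eqP (forallP cS k)).
have cover_bad : setX draws P :\: good \subset \bigcup_(p in arcs) fails p.
  apply/subsetP => -[A S]; rewrite !inE /= => /andP[+ /andP[/andP[sA cA] /andP[indS cS]]].
  rewrite sA cA indS cS /= => nindU.
  case: (pickP [pred p : T * T | [&& p.1 \in A, p.2 \in S & e p.1 p.2]]).
    move=> [v w] /= /and3P[vA wS evw]; apply/bigcupP; exists (v, w).
      by rewrite inE /= evw (subsetP sA).
    by rewrite !inE /= sA cA vA indS cS wS.
  (* Both parts are independent, so an edge inside the union would have to join [A] to [S]. *)
  move=> noedge; case/negP: nindU; apply/independentP => x y.
  have /independentP indA := independentS sA (indV i).
  move/independentP: indS => indS.
  rewrite !inE => /orP[xA|xS] /orP[yA|yS]; [exact: indA| | |exact: indS].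
    by have := noedge (x, y); rewrite /= xA yS => /negbT.
  by have := noedge (y, x); rewrite /= yA xS e_sym => /negbT.
have le_fails p : p \in arcs ->
    (#|V i| * t * #|fails p| <= s * 'C(#|V i|, s) * (2 * s * #|P|))%N.
  rewrite inE => /andP[_ pV]; rewrite cardsX mulnACA.
  by apply: leq_mul (memP _); apply: card_draws_mem.
have le_bad : (2 * #|setX draws P :\: good| <= 'C(#|V i|, s) * #|P|)%N.
  have Vt0 : (0 < #|V i| * t)%N by rewrite muln_gt0 t0 (leq_trans t0 tV).
  rewrite -(leq_pmul2l Vt0) mulnCA.
  have le1 : (#|V i| * t * #|setX draws P :\: good|
      <= #|arcs| * (s * 'C(#|V i|, s) * (2 * s * #|P|)))%N.
    rewrite -[leqRHS]sum_nat_const.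
    apply: (@leq_trans (\sum_(p in arcs) #|V i| * t * #|fails p|)); last exact: leq_sum.
    rewrite -big_distrr leq_mul2l; apply/orP; right.
    apply: leq_trans (subset_leq_card cover_bad) _.
    elim/big_rec2: _ => [|p m B _ leB]; first by rewrite cards0.
    by rewrite (leq_trans (leq_card_setU _ _).1) // leq_add2l.
  apply: leq_trans (leq_mul (leqnn 2) le1) _.
  (* Origin of the constant 4 s^2: a factor 2 for losing at most half, [s] from the subsets and
     [2 * s] from the blow-ups. *)
  have -> : (2 * (#|arcs| * (s * 'C(#|V i|, s) * (2 * s * #|P|)))
      = 4 * s ^ 2 * #|arcs| * ('C(#|V i|, s) * #|P|))%N by ring.
  rewrite leq_mul2r [(#|V i| * t)%N]mulnC (leq_trans _ eV) ?orbT //.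
  by rewrite leq_mul2l card_arcs_incident ?orbT.
have cardX : #|setX draws P| = ('C(#|V i|, s) * #|P|)%N by rewrite cardsX cards_draws.
have := cardsID good (setX draws P); rewrite cardX.
have -> : setX draws P :&: good = good.
  by apply/setIidPr/subsetP => q; rewrite inE => /andP[].
rewrite -/P -/P'; lia.
Qed.

(** Induction on the size of [J], always for all [i] outside [J]: to bound the blow-ups through [w]
    in block [j], the claim is used for [J :\ j] extended by [j]. *)
Lemma blowups_extend (T : finType) (e : rel T) (r : nat)
    (V : 'I_r -> {set T}) (s t : nat) :
  symmetric e -> multipartite e V -> (0 < t)%N ->
  (forall i, t <= #|V i|)%N ->
  (forall i, 4 * s ^ 2 * #|incident_edges e (V i)| <= t * #|V i|)%N ->
  forall (J : {set 'I_r}) (i : 'I_r), i \notin J ->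
  ('C(#|V i|, s) * #|partial_blowups e V s J|
     <= 2 * #|partial_blowups e V s (i |: J)|)%N.
Proof.
move=> e_sym mV t0 tV eV J; have [n] := ubnP #|J|.
elim: n J => // n IHn J; rewrite ltnS => leJ i iJ.
apply: (blowups_extend_step e_sym mV _ (eV i) _ iJ) => [|w]; first by rewrite t0 tV.
have [covV _ _] := mV; have [j wVj] := covV w.
(* If the block of [w] lies outside [J], no blow-up on [J] contains [w]. *)
have [jJ|jJ] := boolP (j \in J); last first.
  rewrite [X in (t * X)%N]eq_card0 ?muln0 // => S; rewrite inE; apply/negbTE/andP => -[SP wS].
  by rewrite (partial_blowups_block SP wS wVj) in jJ.
apply: leq_trans (leq_mul (tV j) (leqnn _)) _.
apply: leq_trans (card_partial_blowups_mem s mV jJ wVj) _.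
rewrite -mulnA [(2 * s)%N]mulnC -mulnA leq_mul2l; apply/orP; right.
rewrite -{2}(setD1K jJ); apply: IHn; last by rewrite !inE eqxx.
by move: leJ; rewrite (cardsD1 j J) jJ add1n.
Qed.

(** Adding the blocks one at a time telescopes [blowups_extend], with C(|V_i|, s) bounded below by
    C(t, s); the empty set starts the count. *)
Lemma blowups_lower_bound (T : finType) (e : rel T) (r : nat)
    (V : 'I_r -> {set T}) (s t : nat) :
  symmetric e -> multipartite e V -> (0 < t)%N ->
  (forall i, t <= #|V i|)%N ->
  (forall i, 4 * s ^ 2 * #|incident_edges e (V i)| <= t * #|V i|)%N ->
  ('C(t, s) ^ r <= 2 ^ r * #|transversal_blowups e V s|)%N.
Proof.
move=> e_sym mV t0 tV eV.
have bound (J : {set 'I_r}) : ('C(t, s) ^ #|J| <= 2 ^ #|J| * #|partial_blowups e V s J|)%N.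
  have [n] := ubnP #|J|; elim: n J => // n IHn J leJ.
  have [->|[i iJ]] := set_0Vmem J.
    rewrite cards0 mul1n card_gt0; apply/set0Pn; exists set0.
    rewrite inE; apply/andP; split; first by apply/independentP => x y; rewrite inE.
    by apply/forallP => i; rewrite set0I cards0 inE.
  have iJ' : i \notin J :\ i by rewrite !inE eqxx.
  have := blowups_extend e_sym mV t0 tV eV iJ'; rewrite setD1K // => ext.
  move: leJ; rewrite (cardsD1 i J) iJ add1n ltnS !expnS => /IHn le1.
  apply: leq_trans (leq_mul (leq_bin2l s (tV i)) le1) _.
  by rewrite mulnCA [(2 * _)%N]mulnC -mulnA leq_mul2l ext orbT.
have := bound setT; rewrite cardsT card_ord.
congr (_ <= _ * _)%N; apply: eq_card => S; rewrite !inE; congr (_ && _).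
by apply: eq_forallb => i; rewrite inE mul1n.
Qed.

Theorem theorem5p8 (R : realFieldType) (s : nat) (hs : (1 <= s)%N)
    (T : finType) (e : rel T) (e_sym : symmetric e) (e_irr : irreflexive e)
    (r : nat) (V : 'I_r -> {set T}) (hV : multipartite e V) :
  (forall t : nat, (1 <= t)%N ->
     (forall i : 'I_r, (t <= #|V i|)%N /\
        #|incident_edges e (V i)|%:R
          <= t%:R / (4 * s%:R ^+ 2) * #|V i|%:R :> R) ->
     1 / 2 ^+ r * 'C(t, s)%:R ^+ r <= #|transversal_blowups e V s|%:R :> R)
  /\
  (forall (D : R) (N : nat), 0 < D -> 4 * s%:R ^+ 2 * D = N%:R ->
     max_block_avg_degree R e V <= D ->
     thick V (4 * s%:R ^+ 2 * D) ->
     1 / 2 ^+ r * 'C(N, s)%:R ^+ r <= #|transversal_blowups e V s|%:R :> R).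

Proof.
have s4_gt0 : 0 < 4 * s%:R ^+ 2 :> R by rewrite mulr_gt0 ?exprn_gt0 ?ltr0n.
have part1 (t : nat) : (1 <= t)%N ->
     (forall i : 'I_r, (t <= #|V i|)%N /\
        #|incident_edges e (V i)|%:R
          <= t%:R / (4 * s%:R ^+ 2) * #|V i|%:R :> R) ->
     1 / 2 ^+ r * 'C(t, s)%:R ^+ r <= #|transversal_blowups e V s|%:R :> R.
  move=> t0 tV; rewrite mul1r ler_pdivrMl ?exprn_gt0 //.
  rewrite -!natrX -natrM ler_nat; apply: (blowups_lower_bound e_sym hV t0).
    by move=> i; have [] := tV i.
  move=> i; have [_] := tV i; rewrite mulrAC ler_pdivlMr // mulrC.
  by rewrite -natrX -!natrM ler_nat.
split=> // D N D0 eN avgD thickV; apply: part1.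
  by rewrite -(ltr0n R) -eN mulr_gt0.
move=> i; have := thickV i; rewrite eN ler_nat => NV; split=> //.
have N0 : (0 < N)%N by rewrite -(ltr0n R) -eN mulr_gt0.
have V0 : 0 < #|V i|%:R :> R by rewrite ltr0n (leq_trans N0 NV).
(* With t = N the edge bound of part (1) reads D |V_i|, which the degree sum of the block
   satisfies. *)
have -> : N%:R / (4 * s%:R ^+ 2) = D by rewrite -eN mulrAC mulfV ?mul1r // gt_eqF.
have : block_avg_degree R e (V i) <= D.
  exact: le_trans (le_bigmax 0 (fun k => block_avg_degree R e (V k)) i) avgD.
rewrite /block_avg_degree ler_pdivrMl // mulrC; apply: le_trans.
by rewrite -natr_sum ler_nat card_incident_degree.
Qed.
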